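(* Let $n\ge 2$, $v\ge 2$ and $k\ge 1$, and let $W$ be a balanced generalized weighing matrix $BGW(v,k,\lambda;\mathbb{Z}_n)$. Let $A_{0,i}$, $A_1$, $A_{2,i}$, $A_3$ ($0\le i\le n-1$) be the $2nv\times 2nv$ $(0,1)$-matrices associated with $W$ as defined in the context. Then the following hold: 1. If $k=v$, then $\{A_{0,i},A_1,A_{2,i}\mid 0\le i\le n-1\}$ is a commutative association scheme. 2. If $k<v$, then $\{A_{0,i},A_1,A_{2,i},A_3\mid 0\le i\le n-1\}$ is a commutative association scheme. 3. The association schemes in 1 and 2 are symmetric if and only if $n=2$.
   Context: Balanced generalized weighing matrices. Let $\mathbb{Z}_n=\{\bar 0,\bar 1,\dots,\overline{n-1}\}$ be the additive cyclic group of order $n$. A $BGW(v,k,\lambda;\mathbb{Z}_n)$ is a $v\times v$ matrix $W=(w_{ij})$ with entries in $\mathbb{Z}_n\cup\{0\}$, where $0$ is a formal zero symbol different from the group element $\bar 0$, such that each row has exactly $k$ nonzero entries (entries in $\mathbb{Z}_n$) and, for any distinct rows $i,j$, the multiset $\{w_{i\ell}-w_{j\ell}\mid w_{i\ell},w_{j\ell}\in\mathbb{Z}_n\}$ contains every element of $\mathbb{Z}_n$ exactly $\lambda/n$ times. The matrices $B_i$. For $0\le i\le n-1$, $B_i$ is the $v\times v$ $(0,1)$-matrix with $(B_i)_{ab}=1$ if and only if $w_{ab}=\bar i$. Indices of $B$ are taken modulo $n$. The adjacency matrices. Let $P=\mathrm{circ}(0,1,0,\dots,0)$ be the $n\times n$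 circulant permutation matrix with first row $(0,1,0,\dots,0)$; $I_m$ and $J_m$ denote the identity and all-ones matrices of order $m$. Define, for $0\le i\le n-1$, $$A_{0,i}=\begin{bmatrix}P^i\otimes I_v&0\\0&P^i\otimes I_v\end{bmatrix},\qquad A_1=\begin{bmatrix}J_n\otimes(J_v-I_v)&0\\0&J_n\otimes(J_v-I_v)\end{bmatrix},$$ $$A_{2,i}=\begin{bmatrix}0&\sum_{j=0}^{n-1}P^j\otimes B_{i+j}\\ \sum_{j=0}^{n-1}P^j\otimes B_{-i-j}^t&0\end{bmatrix},\qquad A_3=\begin{bmatrix}0&J_n\otimes\left(J_v-\sum_{j=0}^{n-1}B_j\right)\\ J_n\otimes\left(J_v-\sum_{j=0}^{n-1}B_j^t\right)&0\end{bmatrix}.$$ Association schemes. A commutative association scheme with $d$ classes on a finite set $X$ is a collection of nonzero $(0,1)$-matrices $A_0,A_1,\dots,A_d$ indexed by $X$ such that: $A_0=I_{|X|}$; $\sum_{i=0}^d A_i=J_{|X|}$; $A_i^t\in\{A_1,\dots,A_d\}$ for every $i\in\{1,\dots,d\}$; every product $A_iA_j$ is a linear combination of $A_0,\dots,A_d$; and $A_iA_j=A_jA_i$ for all $i,j$. It is symmetric if $A_i^t=A_i$ for all $i$. In the present case the identity matrix is $A_{0,0}$. *)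

(* Defs.v *)
From HB Require Import structures.
From mathcomp Require Import all_boot all_order all_algebra.
From mathcomp Require Export mxtens.

Set Implicit Arguments.
Unset Strict Implicit.
Unset Printing Implicit Defensive.

Import Order.TTheory GRing.Theory Num.Theory.
Local Open Scope ring_scope.

(* Throughout, 'Z_n is the cyclic group of order n only for 1 < n. The formal  *)
(* zero symbol of a weighing matrix is None, the group element i is Some i.    *)

Definition odiff (n : nat) (x y : option 'Z_n) : option 'Z_n :=
  match x, y with
  | Some a, Some b => Some (a - b)
  | _, _ => None
  end.

(* The divisibility condition makes the truncated quotient the exact one.      *)
Definition is_BGW (n v k lambda : nat) (W : 'M[option 'Z_n]_v) : Prop :=
  [/\ (forall i : 'I_v, #|[set l | W i l != None]| = k),
      (n %| lambda)%N
    & forall i j : 'I_v, i != j -> forall g : 'Z_n,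
        #|[set l | odiff (W i l) (W j l) == Some g]| = (lambda %/ n)%N].

(* circ n c has first row (c 0, ..., c (n - 1)).                               *)
Definition circ (R : Type) (n : nat) (c : nat -> R) : 'M[R]_n :=
  \matrix_(a, b) c ((b + (n - a)) %% n)%N.

Definition index1 (n : nat) : finType := ('Z_n + (unit + 'Z_n))%type.

Definition index2 (n : nat) : finType := ('Z_n + (unit + ('Z_n + unit)))%type.

Definition base1 (n : nat) : index1 n := inl 0.

Definition base2 (n : nat) : index2 n := inl 0.

Section Matrices.
Variables (R : numFieldType) (n v : nat) (W : 'M[option 'Z_n]_v).

Definition Pmx : 'M[R]_n := circ n (fun j => (j == 1%N)%:R).

Definition Jmx (m : nat) : 'M[R]_m := const_mx 1.

Definition Bmx (i : 'Z_n) : 'M[R]_v := \matrix_(a, b) (W a b == Some i)%:R.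

Definition A0mx (i : 'Z_n) : 'M[R]_(n * v + n * v) :=
  block_mx (Pmx ^+ i *t 1%:M) 0
           0 (Pmx ^+ i *t 1%:M).

Definition A1mx : 'M[R]_(n * v + n * v) :=
  block_mx (Jmx n *t (Jmx v - 1%:M)) 0
           0 (Jmx n *t (Jmx v - 1%:M)).

Definition A2mx (i : 'Z_n) : 'M[R]_(n * v + n * v) :=
  block_mx 0 (\sum_(j : 'Z_n) Pmx ^+ j *t Bmx (i + j))
           (\sum_(j : 'Z_n) Pmx ^+ j *t (Bmx (- i - j))^T) 0.

Definition A3mx : 'M[R]_(n * v + n * v) :=
  block_mx 0 (Jmx n *t (Jmx v - \sum_(j : 'Z_n) Bmx j))
           (Jmx n *t (Jmx v - \sum_(j : 'Z_n) (Bmx j)^T)) 0.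

Definition family1 (t : index1 n) : 'M[R]_(n * v + n * v) :=
  match t with
  | inl i => A0mx i
  | inr (inl _) => A1mx
  | inr (inr i) => A2mx i
  end.

Definition family2 (t : index2 n) : 'M[R]_(n * v + n * v) :=
  match t with
  | inl i => A0mx i
  | inr (inl _) => A1mx
  | inr (inr (inl i)) => A2mx i
  | inr (inr (inr _)) => A3mx
  end.

End Matrices.

(* The point set is 'I_N. The classes are indexed by a finite type T with a    *)
(* base index t0 instead of 0, ..., d, so that d = #|T| - 1; the members are    *)
(* pairwise distinct because they are nonzero (0,1)-matrices summing to J.     *)
Record comm_assoc_scheme (R : numFieldType) (N : nat) (T : finType) (t0 : T)
    (A : T -> 'M[R]_N) : Prop := CommAssocScheme {
  scheme_01 : forall t x y, A t x y = 0 \/ A t x y = 1;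
  scheme_neq0 : forall t, A t != 0;
  scheme_id : A t0 = 1%:M;
  scheme_sum : \sum_t A t = const_mx 1;
  scheme_tr : forall t, t != t0 -> exists2 s, s != t0 & (A t)^T = A s;
  scheme_mul : forall s t, exists c : T -> R,
    A s *m A t = \sum_u c u *: A u;
  scheme_comm : forall s t, A s *m A t = A t *m A s
}.

Definition symmetric_scheme (R : numFieldType) (N : nat) (T : finType)
    (A : T -> 'M[R]_N) : Prop :=
  forall t, (A t)^T = A t.

(* Main.v *)
Require Import Defs.
From HB Require Import structures.
From mathcomp Require Import all_boot all_order all_algebra.
From mathcomp Require Import ring.

Set Implicit Arguments.
Unset Strict Implicit.
Unset Printing Implicit Defensive.

Import Order.TTheory GRing.Theory Num.Theory.
Local Open Scope ring_scope.

(** All matrices of the family are built from block circulants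
    [sum_j P^j (x) f j], which multiply by convolution of [f] over Z_n.  The BGW
    axiom says that D = sum_j P^j (x) B_j satisfies D D^T = k + J (x) M with
    M = (lambda/n)(J - I), so the only real issue is to obtain the same formula for D^T D.
    Modulo the idempotent n^-1 J (x) I the relation reads D D^T = k, and one-sided
    inverses of square matrices are two-sided, hence D^T D = k + J (x) M' for some
    M'.  Comparing diagonal entries shows that every column of W has k nonzero
    entries; the zero-nonzero pattern S of W then satisfies S^T S = S S^T (S is
    invertible unless k = v, where S = J), which forces M' = M. *)

(** * Block circulant matrices over Z_n and their multiplication *)

Section BlockCirculant.
Variables (R : numFieldType) (m v : nat).
(* With n = m.+2 the types 'I_n and 'Z_n are convertible. *)
Local Notation n := m.+2.
Local Notation P := (Pmx R n).

Lemma PmxE (a b : 'Z_n) : P a b = (b - a == 1)%:R.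
Proof.
rewrite mxE -val_eqE /= modnDmr.
by congr (_ == _)%:R; rewrite modn_small.
Qed.

Lemma Pmx_expE (i : nat) : P ^+ i = \matrix_(a, b) ((b - a : 'Z_n) == i%:R)%:R.
Proof.
elim: i => [|i IHi].
  rewrite expr0; apply/matrixP => a b; rewrite !mxE (subr_eq0 b a) eq_sym.
  by [].
rewrite exprS IHi; apply/matrixP => a b; rewrite !mxE.
rewrite (bigD1 (a + 1 : 'Z_n)) //= PmxE mxE addrAC subrr add0r eqxx mul1r.
rewrite big1 ?addr0 => [|c /negPf nec]; last first.
  by rewrite PmxE subr_eq addrC nec mul0r.
by rewrite opprD addrA subr_eq -natr1.
Qed.

(** The exponent on the left is the representative of i + j modulo n. By [Pmx_expE] a power of P
    depends only on the class of its exponent. *)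
Lemma Pmx_expD (i j : 'Z_n) : P ^+ (i + j)%R = P ^+ i *m P ^+ j.
Proof.
rewrite -[P ^+ i *m _]/(P ^+ i * P ^+ j) -exprD !Pmx_expE.
by apply/matrixP => a b; rewrite !mxE natrD !natr_Zp.
Qed.

(** The image of the group ring element sum_j f(j) x^j, with matrix coefficients, under x -> P. *)
Definition bcirc (f : 'Z_n -> 'M[R]_v) : 'M[R]_(n * v) :=
  \sum_(j : 'Z_n) P ^+ j *t f j.

Lemma bcircE f (a b : 'Z_n) x y :
  bcirc f (mxtens_index (a, x)) (mxtens_index (b, y)) = f (b - a) x y.
Proof.
rewrite summxE (bigD1 (b - a)) // tensmxE Pmx_expE mxE natr_Zp eqxx mul1r.
rewrite big1 ?[LHS]addr0 // => j /negPf nej.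
by rewrite tensmxE Pmx_expE mxE natr_Zp eq_sym nej mul0r.
Qed.

Lemma bcircP (A : 'M[R]_(n * v)) (f : 'Z_n -> 'M[R]_v) :
  (forall (a b : 'Z_n) x y,
     A (mxtens_index (a, x)) (mxtens_index (b, y)) = f (b - a) x y) ->
  A = bcirc f.
Proof.
move=> eqA; apply/matrixP => p q.
by case: (mxtens_indexP p) (mxtens_indexP q) => a x [b y]; rewrite eqA bcircE.
Qed.

Lemma eq_bcirc f g : f =1 g -> bcirc f = bcirc g.
Proof. by move=> eqfg; apply: eq_bigr => j _; rewrite eqfg. Qed.

Lemma bcirc_inj f g : bcirc f = bcirc g -> f =1 g.
Proof.
move=> eqfg j; apply/matrixP => x y.
by rewrite -[j](subr0 j) -!bcircE eqfg.
Qed.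

Lemma bcircD f g : bcirc f + bcirc g = bcirc (fun j => f j + g j).
Proof. by apply: bcircP => a b x y; rewrite !mxE !bcircE. Qed.

Lemma bcircZ c f : c *: bcirc f = bcirc (fun j => c *: f j).
Proof. by apply: bcircP => a b x y; rewrite !mxE !bcircE. Qed.

Lemma bcirc_sum (I : finType) (F : I -> 'Z_n -> 'M[R]_v) :
  \sum_i bcirc (F i) = bcirc (fun j => \sum_i F i j).
Proof.
apply: bcircP => a b x y; rewrite !summxE.
by apply: eq_bigr => i _; rewrite bcircE.
Qed.

Lemma tens_bcirc (i : 'Z_n) (M : 'M[R]_v) :
  P ^+ i *t M = bcirc (fun j => (j == i)%:R *: M).
Proof.
by apply: bcircP => a b x y; rewrite tensmxE Pmx_expE !mxE natr_Zp.
Qed.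

(** J_n is the sum of all powers of P, so every coefficient is the same. *)
Lemma tensJ_bcirc (M : 'M[R]_v) : Jmx R n *t M = bcirc (fun=> M).
Proof. by apply: bcircP => a b x y; rewrite tensmxE mxE mul1r. Qed.

Lemma bcirc1 : 1%:M = bcirc (fun j => (j == 0)%:R%:M).
Proof.
apply: bcircP => a b x y; rewrite !mxE (inj_eq (can_inj (@mxtens_indexK _ _))).
rewrite xpair_eqE subr_eq0 (eq_sym b).
by case: (a == b); case: (x == y).
Qed.

Lemma tr_bcirc f : (bcirc f)^T = bcirc (fun j => (f (- j))^T).
Proof. by apply: bcircP => a b x y; rewrite !mxE bcircE opprB. Qed.

Lemma mul_bcirc f g :
  bcirc f *m bcirc g = bcirc (fun j => \sum_i f i *m g (j - i)).
Proof.
rewrite mulmx_suml.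
under eq_bigr => i _ do rewrite mulmx_sumr.
(* Shifting the inner index by i groups the terms by the total power of P. *)
transitivity (\sum_(i : 'Z_n) \sum_(j : 'Z_n) P ^+ j *t (f i *m g (j - i))).
  apply: eq_bigr => i _; rewrite [RHS](reindex_inj (addrI i)) /=.
  by apply: eq_bigr => j _; rewrite tensmx_mul Pmx_expD addrAC subrr add0r.
rewrite exchange_big; apply: eq_bigr => j _.
by apply/matrixP => p q; rewrite summxE !mxE summxE mulr_sumr;
  apply: eq_bigr => i _; rewrite mxE.
Qed.

End BlockCirculant.

(** * Counting identities and commutation modulo an idempotent *)

Lemma sum_indicator (R : numFieldType) (I : finType) (p : pred I) :
  \sum_i (p i)%:R = #|[set i | p i]|%:R :> R.
Proof.
rewrite -sum1_card natr_sum [RHS](eq_bigl p) => [|i]; last by rewrite inE.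
by rewrite [RHS]big_mkcond; apply: eq_bigr => i _; case: (p i).
Qed.

Lemma Jmx_mul (R : numFieldType) v : Jmx R v *m Jmx R v = v%:R *: Jmx R v.
Proof.
apply/matrixP => x y; rewrite !mxE mulr1.
under eq_bigr => z _ do rewrite !mxE mulr1.
by rewrite sumr_const card_ord.
Qed.

(* If D D' = k modulo the idempotent H, then D (1 - H) + H is invertible with  *)
(* inverse k^-1 D' (1 - H) + H, so the two factors commute modulo H.           *)
Lemma mulmxC_mod_idempotent (R : numFieldType) N (D D' H : 'M[R]_N) (k : R) :
  k != 0 -> H *m H = H -> D *m H = H *m D -> D' *m H = H *m D' ->
  D *m D' *m (1%:M - H) = k *: (1%:M - H) ->
  D' *m D *m (1%:M - H) = k *: (1%:M - H).
Proof.
move=> k0 HH DH D'H; move defQ: (1%:M - H) => Q DD'.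
have HQ : H *m Q = 0 by rewrite -defQ mulmxBr mulmx1 HH subrr.
have QH : Q *m H = 0 by rewrite -defQ mulmxBl mul1mx HH subrr.
have QQ : Q *m Q = Q by rewrite -{1}defQ mulmxBl mul1mx HQ subr0.
(* H and Q are orthogonal idempotents and B commutes with both, so the cross terms vanish. *)
have mulE A B : B *m H = H *m B ->
    (A *m Q + H) *m (B *m Q + H) = A *m B *m Q + H.
  move=> BH; have BQ : Q *m B = B *m Q.
    by rewrite -defQ mulmxBl mulmxBr mul1mx mulmx1 BH.
  rewrite mulmxDl !mulmxDr HH (mulmxA H) -BH -(mulmxA B) HQ mulmx0 add0r.
  rewrite -(mulmxA A Q H) QH mulmx0 addr0 -(mulmxA A Q) (mulmxA Q) BQ.
  by rewrite -(mulmxA B) QQ mulmxA.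
have E1 : (D *m Q + H) *m ((k^-1 *: D') *m Q + H) = 1%:M.
  rewrite mulE -?scalemxAr -?scalemxAl ?D'H // DD' scalerA mulVf // scale1r.
  by rewrite -defQ subrK.
move/mulmx1C: E1; rewrite mulE // -!scalemxAl => /(canRL (addrK _)) E2.
by rewrite -[LHS](scalerKV k0) E2 defQ.
Qed.

(** * Gram matrices of the weighing matrix and of its support *)

Section Weighing.
Variables (R : numFieldType) (m v k lambda : nat).
Local Notation n := m.+2.
Variable W : 'M[option 'Z_n]_v.
Hypothesis hk : (0 < k)%N.
Hypothesis hW : is_BGW k lambda W.

Local Notation B := (Bmx R W).
Local Notation J := (Jmx R v).
Local Notation mu := ((lambda %/ n)%:R : R).

Definition support_mx : 'M[R]_v := \sum_(j : 'Z_n) B j.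
Local Notation S := support_mx.

Lemma support_mxE x y : S x y = (W x y != None)%:R.
Proof.
rewrite summxE; case E: (W x y) => [i|]; last first.
  by rewrite big1 // => j _; rewrite mxE E.
rewrite (bigD1 i) // mxE E eqxx big1 ?[LHS]addr0 // => j /negPf ne.
by rewrite mxE E (inj_eq Some_inj) eq_sym ne.
Qed.

(** Only the a carried by y can contribute. This turns the difference counts of the BGW axiom into
    entries of products of the B_i. *)
Lemma odiff_count (x y : option 'Z_n) (g : 'Z_n) :
  \sum_a (x == Some (g + a))%:R * (y == Some a)%:R
  = (odiff x y == Some g)%:R :> R.
Proof.
case: y => [b|]; last first.
  by rewrite big1 => [|a _]; [case: x | rewrite mulr0].
rewrite (bigD1 b) // eqxx mulr1 big1 ?[LHS]addr0 => [|a /negPf ne]; last first.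
  by rewrite (inj_eq Some_inj) (eq_sym b) ne mulr0.
by case: x => [a|] //=; rewrite !(inj_eq Some_inj) subr_eq.
Qed.

(** The left side is the coefficient of P^g in D D^T. Off the diagonal this is the BGW axiom; on the
    diagonal every nonzero entry has difference 0 with itself, so the k such entries all count for g
    = 0. *)
Lemma gram_rows (g : 'Z_n) :
  \sum_(a : 'Z_n) B (g + a) *m (B a)^T
  = k%:R *: (g == 0)%:R%:M + mu *: (J - 1%:M).
Proof.
have [rowW _ diffW] := hW; apply/matrixP => x y; rewrite summxE.
under eq_bigr => a _ do [rewrite mxE; under eq_bigr => l _ do rewrite !mxE].
rewrite exchange_big /=; under eq_bigr => l _ do rewrite odiff_count.
rewrite sum_indicator !mxE; have [<-{y}|nexy] := eqVneq x y; last first.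
  by rewrite diffW // subr0 !mulr1 mulr0 add0r.
rewrite subrr mulr0 addr0.
have [->|ne0] := eqVneq g 0.
  rewrite mulr1 -(rowW x); congr (_%:R); apply: eq_card => l; rewrite !inE.
  by case: (W x l) => [a|] //=; rewrite subrr eqxx.
rewrite mulr0 (_ : [set _ | _] = set0) ?cards0 //; apply/setP => l; rewrite !inE.
by case: (W x l) => [a|] //=; rewrite subrr (inj_eq Some_inj) eq_sym (negPf ne0).
Qed.

Lemma gram_cols_mod :
  exists M : 'M[R]_v, forall g : 'Z_n,
  \sum_(a : 'Z_n) (B a)^T *m B (g + a) = k%:R *: (g == 0)%:R%:M + M.
Proof.
pose D := bcirc (B : 'Z_n -> _).
(* This is the idempotent n^-1 J (x) I; multiplying by it averages the coefficients over Z_n. *)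
pose H := bcirc (fun _ : 'Z_n => n%:R^-1 *: 1%:M : 'M[R]_v).
have n0 : n%:R != 0 :> R by rewrite pnatr_eq0.
have mulH f : bcirc f *m H = bcirc (fun=> n%:R^-1 *: \sum_j f j).
  rewrite mul_bcirc; apply: eq_bcirc => j.
  by rewrite scaler_sumr; apply: eq_bigr => i _; rewrite -scalemxAr mulmx1.
have Hmul f : H *m bcirc f = bcirc (fun=> n%:R^-1 *: \sum_j f j).
  rewrite mul_bcirc; apply: eq_bcirc => j.
  rewrite scaler_sumr [RHS](reindex_inj (can_inj (subKr j))) /=.
  by apply: eq_bigr => i _; rewrite -scalemxAl mul1mx.
have mulH_const M : bcirc (fun=> M) *m H = bcirc (fun=> M).
  rewrite mulH; apply: eq_bcirc => j; rewrite sumr_const card_ord.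
  by rewrite -scaler_nat scalerA mulVf ?scale1r.
have DDt : D *m D^T = k%:R *: 1%:M + bcirc (fun=> mu *: (J - 1%:M)).
  rewrite tr_bcirc mul_bcirc bcirc1 bcircZ bcircD; apply: eq_bcirc => g'.
  rewrite -gram_rows (reindex_inj (addrI g')) /=.
  by apply: eq_bigr => a _; rewrite opprB addrAC subrr add0r.
have DtD : D^T *m D = bcirc (fun g => \sum_(a : 'Z_n) (B a)^T *m B (g + a)).
  rewrite tr_bcirc mul_bcirc; apply: eq_bcirc => g'.
  rewrite (reindex_inj (@oppr_inj _)) /=.
  by apply: eq_bigr => a _; rewrite !opprK.
have : D^T *m D *m (1%:M - H) = k%:R *: (1%:M - H).
  apply: mulmxC_mod_idempotent.
  - by rewrite pnatr_eq0 -lt0n.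
  - exact: mulH_const.
  - by rewrite mulH Hmul.
  - by rewrite tr_bcirc mulH Hmul.
  (* The second summand of D D^T has constant coefficients, so H fixes it and 1 - H kills it. *)
  rewrite DDt mulmxDl -scalemxAl mul1mx [in X in _ + X]mulmxBr mulmx1.
  by rewrite mulH_const subrr addr0.
(* Solving gives D^T D = k - k H + D^T D H. The last two terms have constant coefficients, and their
   sum provides the witness M. *)
rewrite scalerBr mulmxBr mulmx1 => /(canRL (subrK _)).
rewrite {2}DtD mulH -addrA -scaleNr {1}DtD bcirc1 2!bcircZ !bcircD.
by move/bcirc_inj => E; eexists => g'; rewrite E; congr (_ + _).
Qed.

Lemma support_mulJ : S *m J = k%:R *: J.
Proof.
have [rowW _ _] := hW; apply/matrixP => x y; rewrite !mxE mulr1.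
under eq_bigr => l _ do rewrite support_mxE mxE mulr1.
by rewrite sum_indicator rowW.
Qed.

(* Comparing the diagonals of [gram_cols_mod] at g = 0 and g = 1. *)
Lemma J_mul_support : J *m S = k%:R *: J.
Proof.
have [M gramM] := gram_cols_mod; apply/matrixP => x y.
(* An entry of column y cannot equal both a and 1 + a, so the diagonal of the sum at g = 1 vanishes,
   and there the k term is absent. *)
have M0 : M y y = 0.
  move/matrixP/(_ y y): (gramM 1); rewrite summxE big1 => [|a _].
    by rewrite !mxE (negPf (oner_neq0 _)) /= mul0rn mulr0 add0r.
  rewrite mxE big1 // => l _; rewrite !mxE.
  case: (W l y) => [b|]; last by rewrite mul0r.
  rewrite !(inj_eq Some_inj); case: eqP => [->|_]; last by rewrite mul0r.
  by rewrite -subr_eq0 opprD addrCA subrr addr0 oppr_eq0 oner_eq0 mulr0.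
(* At g = 0 the diagonal entry counts the nonzero entries of column y. *)
have := gramM 0; rewrite eqxx => /matrixP/(_ y y).
rewrite !mxE eqxx M0 addr0 mulr1 => <-.
rewrite summxE; under eq_bigr => l _ do rewrite (mxE _ _ x) mul1r summxE.
rewrite exchange_big /=; apply: eq_bigr => a _; rewrite mxE.
by apply: eq_bigr => l _; rewrite !mxE add0r; case: eqP; rewrite ?mulr1 ?mulr0.
Qed.

Lemma J_mul_support_tr : J *m S^T = k%:R *: J.
Proof. by rewrite -[J]trmx_const -trmx_mul support_mulJ linearZ /= trmx_const. Qed.

Lemma support_tr_mulJ : S^T *m J = k%:R *: J.
Proof.
by rewrite -[J]trmx_const -trmx_mul J_mul_support linearZ /= trmx_const.
Qed.

(** Sum [gram_rows] over all g, which amounts to sending P to 1. Since n divides lambda, n mu is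
    lambda. *)
Lemma support_gram_rows :
  S *m S^T = k%:R *: 1%:M + (n%:R * mu) *: (J - 1%:M).
Proof.
transitivity (\sum_(g : 'Z_n) \sum_(a : 'Z_n) B (g + a) *m (B a)^T).
  rewrite exchange_big /= linear_sum mulmx_sumr; apply: eq_bigr => a _.
  by rewrite mulmx_suml (reindex_inj (addIr a)).
under eq_bigr => g _ do rewrite gram_rows.
rewrite big_split /= sumr_const card_ord -scaler_nat scalerA; congr (_ + _).
rewrite (bigD1 0) // eqxx big1 ?[LHS]addr0 // => g /negPf ->.
by rewrite scale_scalar_mx mulr0 raddf0.
Qed.

Lemma support_full : k = v -> S = J.
Proof.
have [rowW _ _] := hW; move=> kv; apply/matrixP => x y.
rewrite support_mxE mxE.
have /eqP : [set l | W x l != None] == setT.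
  by rewrite eqEcard subsetT cardsT card_ord rowW kv leqnn.
by move/setP/(_ y); rewrite !inE => ->.
Qed.

(** Evaluate S S^T J in two ways: by row and column sums, and by the Gram relation. *)
Lemma BGW_counting : (0 < v)%N ->
  k%:R * k%:R = k%:R + n%:R * mu * (v%:R - 1) :> R.
Proof.
move=> v_gt0; pose x := Ordinal v_gt0.
have : S *m S^T *m J = (k%:R * k%:R) *: J.
  by rewrite -mulmxA support_tr_mulJ -scalemxAr support_mulJ scalerA.
rewrite support_gram_rows mulmxDl -!scalemxAl mulmxBl mul1mx Jmx_mul.
by move/matrixP/(_ x x); rewrite !mxE !mulr1 => <-.
Qed.

(** The argument that dualizes a symmetric design. If k = n mu, counting forces k = v and S = J;
    otherwise S has an explicit right inverse built from S^T and J, which is also a left inverse. *)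
Lemma support_gram_cols : (0 < v)%N -> S^T *m S = S *m S^T.
Proof.
move=> v_gt0; have k0 : k%:R != 0 :> R by rewrite pnatr_eq0 -lt0n.
set L := n%:R * mu; have cnt := BGW_counting v_gt0; rewrite -/L in cnt.
have [kL|neL] := eqVneq k%:R L.
  have kv : k = v.
    apply/eqP; rewrite -(eqr_nat R) -(inj_eq (mulfI k0)) cnt -kL.
    by rewrite mulrBr mulr1 addrC subrK.
  by rewrite support_full // trmx_const.
have kL0 : k%:R - L != 0 by rewrite subr_eq0.
have gramE : S *m S^T = (k%:R - L) *: 1%:M + L *: J.
  by rewrite support_gram_rows scalerBr addrCA addrC scalerBl.
(* Since S J = k J, subtracting (L / k) J from S^T removes exactly the term L J from S S^T. *)
have : S *m ((k%:R - L)^-1 *: (S^T - (L / k%:R) *: J)) = 1%:M.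
  rewrite -scalemxAr mulmxBr -scalemxAr support_mulJ scalerA divfK // gramE.
  by rewrite addrK scalerA mulVf // scale1r.
move/mulmx1C; rewrite -scalemxAl => /(canRL (scalerKV kL0)).
rewrite mulmxBl -scalemxAl J_mul_support scalerA divfK //.
by move/(canRL (subrK _)) => ->; rewrite gramE.
Qed.

(** Summing [gram_cols_mod] over all g gives S^T S = k I + n M. Comparison with S S^T = k I + n mu
    (J - I) determines M after division by n. *)
Lemma gram_cols (g : 'Z_n) : (0 < v)%N ->
  \sum_(a : 'Z_n) (B a)^T *m B (g + a)
  = k%:R *: (g == 0)%:R%:M + mu *: (J - 1%:M).
Proof.
move=> v_gt0; have [M gramM] := gram_cols_mod.
have n0 : n%:R != 0 :> R by rewrite pnatr_eq0.
rewrite gramM; congr (_ + _); apply: (scalerI n0).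
have := support_gram_cols v_gt0; rewrite support_gram_rows scalerA.
move/(canLR (addKr _)) => <-.
have -> : S^T *m S = \sum_(h : 'Z_n) \sum_(a : 'Z_n) (B a)^T *m B (h + a).
  rewrite exchange_big [S^T]linear_sum mulmx_suml; apply: eq_bigr => a _.
  by rewrite mulmx_sumr (reindex_inj (addIr a)).
under eq_bigr => h _ do rewrite gramM.
rewrite big_split /= sumr_const card_ord -scaler_nat addrA [X in _ = X + _]addrC.
rewrite (bigD1 0) // eqxx big1 => [|h /negPf ->]; last first.
  by rewrite scale_scalar_mx mulr0 raddf0.
by rewrite [X in X - _]addr0 subrr add0r.
Qed.

End Weighing.

(** * Two-by-two block matrices with block circulant entries *)

Section BlockCirculantProducts.
Variables (R : numFieldType) (m v : nat).
Local Notation n := m.+2.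
Implicit Types (M : 'M[R]_v) (f g : 'Z_n -> 'M[R]_v).

Lemma mul_bcirc_constl M f :
  bcirc (fun _ : 'Z_n => M) *m bcirc f = bcirc (fun=> M *m \sum_j f j).
Proof.
rewrite mul_bcirc; apply: eq_bcirc => j.
by rewrite mulmx_sumr [RHS](reindex_inj (can_inj (subKr j))).
Qed.

Lemma mul_bcirc_constr M f :
  bcirc f *m bcirc (fun _ : 'Z_n => M) = bcirc (fun=> (\sum_j f j) *m M).
Proof. by rewrite mul_bcirc; apply: eq_bcirc => j; rewrite mulmx_suml. Qed.

Lemma mul_bcirc_shiftl (i : 'Z_n) f :
  bcirc (fun j => (j == i)%:R *: 1%:M) *m bcirc f = bcirc (fun j => f (j - i)).
Proof.
rewrite mul_bcirc; apply: eq_bcirc => j; rewrite (bigD1 i) // eqxx scale1r.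
rewrite mul1mx big1 ?[LHS]addr0 // => a /negPf ->.
by rewrite scale0r mul0mx.
Qed.

Lemma mul_bcirc_shiftr (i : 'Z_n) f :
  bcirc f *m bcirc (fun j => (j == i)%:R *: 1%:M) = bcirc (fun j => f (j - i)).
Proof.
rewrite mul_bcirc; apply: eq_bcirc => j; rewrite (bigD1 (j - i)) // subKr eqxx.
rewrite scale1r mulmx1 big1 ?[LHS]addr0 // => a /negPf ne.
by rewrite subr_eq addrC -subr_eq eq_sym ne scale0r mulmx0.
Qed.

Lemma bcirc_01 f :
  (forall j x y, f j x y = 0 \/ f j x y = 1) ->
  forall p q, bcirc f p q = 0 \/ bcirc f p q = 1.
Proof.
move=> f01 p q.
by case: (mxtens_indexP p) (mxtens_indexP q) => a x [b y]; rewrite bcircE.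
Qed.

(** The even part of a Z_2-grading, containing A_{0,i} and A_1; the odd part [anti2] contains
    A_{2,i} and A_3. *)
Definition diag2 f : 'M[R]_(n * v + n * v) :=
  block_mx (bcirc f) 0 0 (bcirc f).

(** Two functions are required because the lower blocks of A_{2,i} and A_3 involve transposes of the
    B_j. *)
Definition anti2 f g : 'M[R]_(n * v + n * v) :=
  block_mx 0 (bcirc f) (bcirc g) 0.

Lemma diag2_01 f : (forall j x y, f j x y = 0 \/ f j x y = 1) ->
  forall p q, diag2 f p q = 0 \/ diag2 f p q = 1.
Proof.
move=> /bcirc_01 f01 p q; rewrite mxE.
by case: (splitP p) => p' _; rewrite mxE; case: (splitP q) => q' _;
  rewrite ?mxE //; left.
Qed.

Lemma anti2_01 f g :
  (forall j x y, f j x y = 0 \/ f j x y = 1) ->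
  (forall j x y, g j x y = 0 \/ g j x y = 1) ->
  forall p q, anti2 f g p q = 0 \/ anti2 f g p q = 1.
Proof.
move=> /bcirc_01 f01 /bcirc_01 g01 p q; rewrite mxE.
by case: (splitP p) => p' _; rewrite mxE; case: (splitP q) => q' _;
  rewrite ?mxE //; left.
Qed.

Lemma diag2_inj f g : diag2 f = diag2 g -> f =1 g.
Proof. by case/eq_block_mx => /bcirc_inj. Qed.

Lemma anti2_injl f g f' g' : anti2 f g = anti2 f' g' -> f =1 f'.
Proof. by case/eq_block_mx => _ /bcirc_inj. Qed.

Lemma diag2_cst0 : diag2 (fun=> 0) = 0.
Proof.
rewrite /diag2 (_ : bcirc _ = 0) ?block_mx0 //.
by rewrite /bcirc big1 // => j _; rewrite tensmx0.
Qed.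

Lemma anti2_cst0 : anti2 (fun=> 0) (fun=> 0) = 0.
Proof.
rewrite /anti2 (_ : bcirc _ = 0) ?block_mx0 //.
by rewrite /bcirc big1 // => j _; rewrite tensmx0.
Qed.

Lemma eq_diag2 f g : f =1 g -> diag2 f = diag2 g.
Proof. by move=> /eq_bcirc E; rewrite /diag2 E. Qed.

Lemma eq_anti2 f g f' g' : f =1 f' -> g =1 g' -> anti2 f g = anti2 f' g'.
Proof. by move=> /eq_bcirc E /eq_bcirc E'; rewrite /anti2 E E'. Qed.

Lemma diag2D f g : diag2 f + diag2 g = diag2 (fun j => f j + g j).
Proof. by rewrite /diag2 add_block_mx !bcircD !addr0. Qed.

Lemma diag2Z c f : c *: diag2 f = diag2 (fun j => c *: f j).
Proof. by rewrite /diag2 scale_block_mx !bcircZ !scaler0. Qed.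

Lemma anti2D f g f' g' :
  anti2 f g + anti2 f' g' = anti2 (fun j => f j + f' j) (fun j => g j + g' j).
Proof. by rewrite /anti2 add_block_mx !bcircD !addr0. Qed.

Lemma anti2Z c f g :
  c *: anti2 f g = anti2 (fun j => c *: f j) (fun j => c *: g j).
Proof. by rewrite /anti2 scale_block_mx !bcircZ !scaler0. Qed.

Lemma diag2_sum (I : finType) (F : I -> 'Z_n -> 'M[R]_v) :
  \sum_i diag2 (F i) = diag2 (fun j => \sum_i F i j).
Proof.
rewrite /diag2 -bcirc_sum; elim/big_rec2: _ => [|i M N _ ->].
  by rewrite block_mx0.
by rewrite add_block_mx !addr0.
Qed.

Lemma anti2_sum (I : finType) (F G : I -> 'Z_n -> 'M[R]_v) :
  \sum_i anti2 (F i) (G i)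
  = anti2 (fun j => \sum_i F i j) (fun j => \sum_i G i j).
Proof.
rewrite /anti2 -!bcirc_sum; elim/big_rec3: _ => [|i M N K _ ->].
  by rewrite block_mx0.
by rewrite add_block_mx !addr0.
Qed.

Lemma tr_diag2 f : (diag2 f)^T = diag2 (fun j => (f (- j))^T).
Proof. by rewrite /diag2 tr_block_mx !tr_bcirc !trmx0. Qed.

Lemma tr_anti2 f g :
  (anti2 f g)^T = anti2 (fun j => (g (- j))^T) (fun j => (f (- j))^T).
Proof. by rewrite /anti2 tr_block_mx !tr_bcirc !trmx0. Qed.

Lemma mul_diag2 f g :
  diag2 f *m diag2 g =
  block_mx (bcirc f *m bcirc g) 0 0 (bcirc f *m bcirc g).
Proof. by rewrite mulmx_block !mulmx0 !mul0mx !addr0 !add0r. Qed.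

Lemma mul_diag2_anti2 f g g' :
  diag2 f *m anti2 g g' =
  block_mx 0 (bcirc f *m bcirc g) (bcirc f *m bcirc g') 0.
Proof. by rewrite mulmx_block !mulmx0 !mul0mx !addr0 !add0r. Qed.

Lemma mul_anti2_diag2 f g g' :
  anti2 g g' *m diag2 f =
  block_mx 0 (bcirc g *m bcirc f) (bcirc g' *m bcirc f) 0.
Proof. by rewrite mulmx_block !mulmx0 !mul0mx !addr0 !add0r. Qed.

(** The two diagonal blocks may differ here. For members of the scheme they coincide because the row
    and column Gram matrices agree. *)
Lemma mul_anti2 f f' g g' :
  anti2 f f' *m anti2 g g' =
  block_mx (bcirc f *m bcirc g') 0 0 (bcirc f' *m bcirc g).
Proof. by rewrite mulmx_block !mulmx0 !mul0mx !addr0 !add0r. Qed.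

End BlockCirculantProducts.

(** * Linear span of a family of matrices *)

Section Span.
Variables (R : numFieldType) (N : nat) (T : finType) (A : T -> 'M[R]_N).

Definition spanned (X : 'M[R]_N) := exists c : T -> R, X = \sum_u c u *: A u.

Lemma spanned_mem u : spanned (A u).
Proof.
exists (fun t => (t == u)%:R); rewrite (bigD1 u) //= eqxx scale1r.
by rewrite big1 ?addr0 // => t /negPf ->; rewrite scale0r.
Qed.

Lemma spanned0 : spanned 0.
Proof. by exists (fun=> 0); rewrite big1 // => u _; rewrite scale0r. Qed.

Lemma spannedD X Y : spanned X -> spanned Y -> spanned (X + Y).
Proof.
move=> [c ->] [d ->]; exists (fun u => c u + d u); rewrite -big_split /=.
by apply: eq_bigr => u _; rewrite scalerDl.
Qed.

Lemma spannedZ a X : spanned X -> spanned (a *: X).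
Proof.
move=> [c ->]; exists (fun u => a * c u); rewrite scaler_sumr.
by apply: eq_bigr => u _; rewrite scalerA.
Qed.

Lemma spanned_sum (I : finType) (F : I -> 'M[R]_N) :
  (forall i, spanned (F i)) -> spanned (\sum_i F i).
Proof. by move=> sF; elim/big_ind: _; [exact: spanned0|exact: spannedD|]. Qed.

End Span.

(** * The matrices of the scheme: normal forms, sums and transposes *)

Section Scheme.
Variables (R : numFieldType) (m v : nat).
Local Notation n := m.+2.
Variable W : 'M[option 'Z_n]_v.

Local Notation B := (Bmx R W).
Local Notation J := (Jmx R v).
Local Notation S := (support_mx R W).

Lemma A0mxE (i : 'Z_n) :
  A0mx R v i = diag2 (fun j => (j == i)%:R *: 1%:M).
Proof. by rewrite /A0mx tens_bcirc. Qed.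

Lemma A1mxE : A1mx R n v = diag2 (fun _ : 'Z_n => J - 1%:M).
Proof. by rewrite /A1mx tensJ_bcirc. Qed.

(** With D = sum_j P^j (x) B_j, the two blocks are D and D^T multiplied by P^(-i) (x) I. This
    explains the index shifts in the products below. *)
Lemma A2mxE (i : 'Z_n) :
  A2mx R W i = anti2 (fun j => B (i + j)) (fun j => (B (- i - j))^T).
Proof. by []. Qed.

Lemma A3mxE :
  A3mx R W = anti2 (fun _ : 'Z_n => J - S) (fun _ : 'Z_n => J - S^T).
Proof. by rewrite /A3mx !tensJ_bcirc -linear_sum. Qed.

Definition mxsE := (A0mxE, A1mxE, A2mxE, A3mxE).

Lemma sum_shift (i : 'Z_n) : \sum_j (j == i)%:R *: 1%:M = 1%:M :> 'M[R]_v.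
Proof.
rewrite (bigD1 i) // eqxx scale1r big1 ?[LHS]addr0 // => j /negPf ->.
by rewrite scale0r.
Qed.

Lemma sum_Bmx (i : 'Z_n) : \sum_j B (i + j) = S.
Proof. by rewrite [RHS](reindex_inj (addrI i)). Qed.

Lemma sum_Bmx_tr (i : 'Z_n) : \sum_j (B (- i - j))^T = S^T.
Proof. by rewrite linear_sum [RHS](reindex_inj (can_inj (subKr (- i)))). Qed.

Lemma sum_cst (M : 'M[R]_v) : \sum_(j : 'Z_n) M = n%:R *: M.
Proof. by rewrite sumr_const card_ord scaler_nat. Qed.

Lemma sum_A0mx : \sum_i A0mx R v i = diag2 (fun _ : 'Z_n => 1%:M).
Proof.
under eq_bigr => i _ do rewrite A0mxE.
rewrite diag2_sum; apply: eq_diag2 => j.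
by under eq_bigr => i _ do rewrite eq_sym; rewrite sum_shift.
Qed.

Lemma sum_A2mx :
  \sum_i A2mx R W i = anti2 (fun _ : 'Z_n => S) (fun _ : 'Z_n => S^T).
Proof.
under eq_bigr => i _ do rewrite A2mxE.
rewrite anti2_sum; apply: eq_anti2 => j.
  by under eq_bigr => i _ do rewrite addrC; rewrite sum_Bmx.
by under eq_bigr => i _ do rewrite [- i - j]addrC; rewrite sum_Bmx_tr.
Qed.

Lemma const_mx1E :
  const_mx 1 = diag2 (fun _ : 'Z_n => J)
             + anti2 (fun _ : 'Z_n => J) (fun _ : 'Z_n => J).
Proof.
have JE : bcirc (fun _ : 'Z_n => J) = const_mx 1.
  by apply/esym/bcircP => a b x y; rewrite !mxE.
by rewrite /diag2 /anti2 JE add_block_mx !addr0 !add0r block_mx_const.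
Qed.

(** The A_3 term is kept separate so that one identity serves both families: it is zero when k = v
    and a class when k < v. *)
Lemma sum_family1 : \sum_t family1 R W t + A3mx R W = const_mx 1.
Proof.
rewrite !big_sumType /= sum_A0mx sum_A2mx (big_pred1 tt) => [|[] //].
rewrite A1mxE A3mxE addrA diag2D -addrA anti2D const_mx1E; congr (_ + _).
  by apply: eq_diag2 => j; rewrite addrC subrK.
by apply: eq_anti2 => j; rewrite addrC subrK.
Qed.

Lemma sum_family2 : \sum_t family2 R W t = const_mx 1.
Proof.
rewrite -sum_family1 !big_sumType /= -!addrA; congr (_ + (_ + (_ + _))).
by rewrite (big_pred1 tt) => [|[] //].
Qed.

Lemma tr_A0mx (i : 'Z_n) : (A0mx R v i)^T = A0mx R v (- i).
Proof.
rewrite !A0mxE tr_diag2; apply: eq_diag2 => j.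
by rewrite linearZ /= trmx1 eqr_oppLR.
Qed.

Lemma tr_A1mx : (A1mx R n v)^T = A1mx R n v.
Proof.
by rewrite A1mxE tr_diag2; apply: eq_diag2 => j; rewrite linearB /= trmx1 trmx_const.
Qed.

Lemma tr_A2mx (i : 'Z_n) : (A2mx R W i)^T = A2mx R W (- i).
Proof.
rewrite !A2mxE tr_anti2; apply: eq_anti2 => j; first by rewrite trmxK opprK.
by rewrite opprK.
Qed.

Lemma tr_A3mx : (A3mx R W)^T = A3mx R W.
Proof.
by rewrite A3mxE tr_anti2; apply: eq_anti2 => j; rewrite linearB /= trmx_const ?trmxK.
Qed.

Lemma A0mx_inj : (0 < v)%N -> injective (@A0mx R n v).
Proof.
move=> v_gt0 i j; rewrite !A0mxE => /diag2_inj/(_ i)/matrixP.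
pose x := Ordinal v_gt0; move/(_ x x); rewrite !mxE !eqxx !mulr1.
by case: eqP => // _ /eqP; rewrite oner_eq0.
Qed.

(** * Multiplication table *)

Lemma mul_A0_A0 (i j : 'Z_n) : A0mx R v i *m A0mx R v j = A0mx R v (i + j).
Proof.
rewrite !A0mxE mul_diag2 mul_bcirc_shiftl; apply: eq_diag2 => a.
by rewrite subr_eq addrC.
Qed.

Lemma mul_A0_A1 (i : 'Z_n) : A0mx R v i *m A1mx R n v = A1mx R n v.
Proof. by rewrite A0mxE A1mxE mul_diag2 mul_bcirc_shiftl. Qed.

Lemma mul_A1_A0 (i : 'Z_n) : A1mx R n v *m A0mx R v i = A1mx R n v.
Proof. by rewrite A0mxE A1mxE mul_diag2 mul_bcirc_shiftr. Qed.

Lemma mul_A0_A2 (i j : 'Z_n) : A0mx R v i *m A2mx R W j = A2mx R W (j - i).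
Proof.
rewrite A0mxE !A2mxE mul_diag2_anti2 !mul_bcirc_shiftl.
by apply: eq_anti2 => a; [rewrite addrAC addrA | rewrite !opprB addrA (addrC (- j))].
Qed.

Lemma mul_A2_A0 (i j : 'Z_n) : A2mx R W j *m A0mx R v i = A2mx R W (j - i).
Proof.
rewrite -mul_A0_A2 A0mxE !A2mxE mul_diag2_anti2 mul_anti2_diag2.
by rewrite !mul_bcirc_shiftl !mul_bcirc_shiftr.
Qed.

Lemma mul_A0_A3 (i : 'Z_n) : A0mx R v i *m A3mx R W = A3mx R W.
Proof. by rewrite A0mxE A3mxE mul_diag2_anti2 !mul_bcirc_shiftl. Qed.

Lemma mul_A3_A0 (i : 'Z_n) : A3mx R W *m A0mx R v i = A3mx R W.
Proof. by rewrite A0mxE A3mxE mul_anti2_diag2 !mul_bcirc_shiftr. Qed.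

(** This and several later products are written with blocks a J + b I or a J + b S, with unit
    coefficients explicit, to match the two patterns treated in [spanned_family2_mul]. *)
Lemma mul_A1_A1 : A1mx R n v *m A1mx R n v =
  diag2 (fun _ : 'Z_n => n%:R *: ((v%:R - 2) *: J + 1 *: 1%:M)).
Proof.
rewrite A1mxE mul_diag2 mul_bcirc_constl; apply: eq_diag2 => _.
rewrite sum_cst -scalemxAr mulmxBl mulmxBr Jmx_mul mul1mx mulmx1.
by congr (_ *: _); apply/matrixP => x y; rewrite !mxE; ring.
Qed.

Variables (k lambda : nat).
Hypothesis hk : (0 < k)%N.
Hypothesis hv : (1 < v)%N.
Hypothesis hW : is_BGW k lambda W.

Local Notation mu := ((lambda %/ n)%:R : R).

Lemma mul_A1_A2 (i : 'Z_n) : A1mx R n v *m A2mx R W i =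
  anti2 (fun _ : 'Z_n => k%:R *: J + (-1) *: S)
        (fun _ : 'Z_n => k%:R *: J + (-1) *: S^T).
Proof.
rewrite A1mxE A2mxE mul_diag2_anti2 !mul_bcirc_constl.
rewrite sum_Bmx sum_Bmx_tr !mulmxBl !mul1mx.
by rewrite (J_mul_support _ hk hW) (J_mul_support_tr _ hW) !scaleN1r.
Qed.

Lemma mul_A2_A1 (i : 'Z_n) : A2mx R W i *m A1mx R n v =
  anti2 (fun _ : 'Z_n => k%:R *: J + (-1) *: S)
        (fun _ : 'Z_n => k%:R *: J + (-1) *: S^T).
Proof.
rewrite A1mxE A2mxE mul_anti2_diag2 !mul_bcirc_constr.
rewrite sum_Bmx sum_Bmx_tr !mulmxBr !mulmx1.
by rewrite (support_mulJ _ hW) (support_tr_mulJ _ hk hW) !scaleN1r.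
Qed.

Lemma mul_A1_A3 : A1mx R n v *m A3mx R W =
  anti2 (fun _ : 'Z_n => n%:R *: ((v%:R - 1 - k%:R) *: J + 1 *: S))
        (fun _ : 'Z_n => n%:R *: ((v%:R - 1 - k%:R) *: J + 1 *: S^T)).
Proof.
rewrite A1mxE A3mxE mul_diag2_anti2 !mul_bcirc_constl !sum_cst -!scalemxAr.
rewrite !mulmxBl !mulmxBr !mul1mx Jmx_mul.
rewrite (J_mul_support _ hk hW) (J_mul_support_tr _ hW) !scale1r !scalerBl.
rewrite scale1r.
by apply: eq_anti2 => _;
  congr (_ *: _); apply/matrixP => x y; rewrite !mxE; ring.
Qed.

Lemma mul_A3_A1 : A3mx R W *m A1mx R n v =
  anti2 (fun _ : 'Z_n => n%:R *: ((v%:R - 1 - k%:R) *: J + 1 *: S))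
        (fun _ : 'Z_n => n%:R *: ((v%:R - 1 - k%:R) *: J + 1 *: S^T)).
Proof.
rewrite A1mxE A3mxE mul_anti2_diag2 !mul_bcirc_constr !sum_cst -!scalemxAl.
rewrite !mulmxBr !mulmxBl !mulmx1 Jmx_mul.
rewrite (support_mulJ _ hW) (support_tr_mulJ _ hk hW) !scale1r !scalerBl.
by apply: eq_anti2 => _;
  congr (_ *: _); apply/matrixP => x y; rewrite !mxE; ring.
Qed.

(** The blocks are D D^T and D^T D, each shifted by P^(-i-j). The coefficient of P^a is the Gram sum
    at g = i + j + a, given by [gram_rows] above and by [gram_cols] below. *)
Lemma mul_A2_A2 (i j : 'Z_n) :
  A2mx R W i *m A2mx R W j = k%:R *: A0mx R v (- i - j) + mu *: A1mx R n v.
Proof.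
rewrite !A2mxE A0mxE A1mxE mul_anti2 !diag2Z diag2D !mul_bcirc.
have eq0 a : (a == - i - j) = (i + j + a == 0).
  by rewrite -opprD -addr_eq0 addrC.
congr (block_mx _ _ _ _); apply: eq_bcirc => a; rewrite scale_scalar_mx mulr1 eq0.
  rewrite -(gram_rows R hW) (reindex_inj (addrI (a + j))) /=.
  by apply: eq_bigr => b _; congr (B _ *m (B _)^T); ring.
rewrite -(gram_cols R hk hW _ (ltnW hv)) (reindex_inj (can_inj (subKr (- i)))) /=.
by apply: eq_bigr => b _; congr ((B _)^T *m B _); ring.
Qed.

Lemma support_gramE :
  S *m S^T = (n%:R * mu) *: J + (k%:R - n%:R * mu) *: 1%:M.
Proof.
rewrite (support_gram_rows R hW); apply/matrixP => x y; rewrite !mxE; ring.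
Qed.

Lemma mul_A2_A3 (i : 'Z_n) : A2mx R W i *m A3mx R W =
  diag2 (fun _ : 'Z_n => (k%:R - n%:R * mu) *: J + (n%:R * mu - k%:R) *: 1%:M).
Proof.
rewrite A2mxE A3mxE mul_anti2 !mul_bcirc_constr sum_Bmx sum_Bmx_tr !mulmxBr.
rewrite (support_mulJ _ hW) (support_tr_mulJ _ hk hW).
rewrite (support_gram_cols _ hk hW (ltnW hv)) support_gramE.
apply: eq_diag2 => _; apply/matrixP => x y; rewrite !mxE; ring.
Qed.

Lemma mul_A3_A2 (i : 'Z_n) : A3mx R W *m A2mx R W i =
  diag2 (fun _ : 'Z_n => (k%:R - n%:R * mu) *: J + (n%:R * mu - k%:R) *: 1%:M).
Proof.
rewrite A2mxE A3mxE mul_anti2 !mul_bcirc_constl sum_Bmx sum_Bmx_tr !mulmxBl.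
rewrite (J_mul_support _ hk hW) (J_mul_support_tr _ hW).
rewrite (support_gram_cols _ hk hW (ltnW hv)) support_gramE.
apply: eq_diag2 => _; apply/matrixP => x y; rewrite !mxE; ring.
Qed.

Lemma mul_A3_A3 : A3mx R W *m A3mx R W =
  diag2 (fun _ : 'Z_n => n%:R *: ((v%:R - k%:R - k%:R + n%:R * mu) *: J
                                  + (k%:R - n%:R * mu) *: 1%:M)).
Proof.
rewrite A3mxE mul_anti2 !mul_bcirc_constl !sum_cst -!scalemxAr.
rewrite !mulmxBl !mulmxBr Jmx_mul (support_mulJ _ hW) (support_tr_mulJ _ hk hW).
rewrite (J_mul_support _ hk hW) (J_mul_support_tr _ hW).
rewrite (support_gram_cols _ hk hW (ltnW hv)) support_gramE.
by apply: eq_diag2 => _;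
  congr (_ *: _); apply/matrixP => x y; rewrite !mxE; ring.
Qed.

Lemma family2_comm s t :
  family2 R W s *m family2 R W t = family2 R W t *m family2 R W s.
Proof.
case: s t => [i|[u|[i|u]]] [j|[u'|[j|u']]] //=;
  rewrite ?(mul_A0_A0, mul_A0_A1, mul_A1_A0, mul_A0_A2, mul_A2_A0) //;
  rewrite ?(mul_A0_A3, mul_A3_A0, mul_A1_A2, mul_A2_A1) //;
  rewrite ?(mul_A1_A3, mul_A3_A1, mul_A2_A3, mul_A3_A2) //.
  by rewrite addrC.
by rewrite !mul_A2_A2 addrC [- i - j]addrC addrC.
Qed.

(** The spanning family A is arbitrary so that the result also covers [family1] when k = v, where
    A_3 = 0 is trivially spanned. *)
Lemma spanned_family2_mul (T : finType) (A : T -> 'M[R]_(n * v + n * v)) :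
  (forall t, spanned A (family2 R W t)) ->
  forall s t, spanned A (family2 R W s *m family2 R W t).
Proof.
move=> sA s t.
have s0 i : spanned A (A0mx R v i) := sA (inl i).
have s1 : spanned A (A1mx R n v) := sA (inr (inl tt)).
have s2 i : spanned A (A2mx R W i) := sA (inr (inr (inl i))).
have s3 : spanned A (A3mx R W) := sA (inr (inr (inr tt))).
(* Write a J + b I = a (J - I) + (a + b) I; the blocks I come from the sum of all A_{0,i}. *)
have sdiag a b : spanned A (diag2 (fun _ : 'Z_n => a *: J + b *: 1%:M)).
  have -> : diag2 (fun _ : 'Z_n => a *: J + b *: 1%:M)
      = a *: A1mx R n v + (a + b) *: \sum_i A0mx R v i.
    rewrite sum_A0mx A1mxE !diag2Z diag2D; apply: eq_diag2 => _.
    by rewrite scalerBr scalerDl addrA subrK.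
  by apply: spannedD; apply: spannedZ => //; apply: spanned_sum.
(* Likewise a J + b S = a (J - S) + (a + b) S, with S coming from the sum of all A_{2,i}. *)
have santi a b : spanned A (anti2 (fun _ : 'Z_n => a *: J + b *: S)
                                  (fun _ : 'Z_n => a *: J + b *: S^T)).
  have -> : anti2 (fun _ : 'Z_n => a *: J + b *: S)
                  (fun _ : 'Z_n => a *: J + b *: S^T)
      = a *: A3mx R W + (a + b) *: \sum_i A2mx R W i.
    rewrite sum_A2mx A3mxE !anti2Z anti2D; apply: eq_anti2 => _;
      by rewrite scalerBr scalerDl addrA subrK.
  by apply: spannedD; apply: spannedZ => //; apply: spanned_sum.
case: s t => [i|[u|[i|u]]] [j|[u'|[j|u']]] /=;
  rewrite ?(mul_A0_A0, mul_A0_A1, mul_A1_A0, mul_A0_A2, mul_A2_A0) //;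
  rewrite ?(mul_A0_A3, mul_A3_A0, mul_A1_A2, mul_A2_A1) //;
  rewrite ?(mul_A1_A3, mul_A3_A1, mul_A2_A3, mul_A3_A2) //;
  rewrite -?anti2Z -?diag2Z; try exact: spannedZ.
- by rewrite mul_A1_A1 -diag2Z; apply: spannedZ.
- by rewrite mul_A2_A2; apply: spannedD; apply: spannedZ.
by rewrite mul_A3_A3 -diag2Z; apply: spannedZ.
Qed.

(** * Verification of the scheme axioms and symmetry *)

Lemma family2_01 t x y : family2 R W t x y = 0 \/ family2 R W t x y = 1.
Proof.
have bool01 (b : bool) : b%:R = 0 \/ b%:R = 1 :> R by case: b; [right | left].
have compl01 (b : bool) : 1 - b%:R = 0 \/ 1 - b%:R = 1 :> R.
  by case: b; rewrite ?subrr ?subr0; [left | right].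
case: t => [i|[u|[i|u]]] /=; rewrite ?mxsE.
- by apply: diag2_01 => j a b; rewrite !mxE -natrM mulnb; exact: bool01.
- by apply: diag2_01 => j a b; rewrite !mxE; exact: compl01.
- by apply: anti2_01 => j a b; rewrite !mxE; exact: bool01.
by apply: anti2_01 => j a b; rewrite !mxE support_mxE; exact: compl01.
Qed.

Lemma A1mx_neq0 : A1mx R n v != 0.
Proof.
rewrite A1mxE; apply/eqP; rewrite -diag2_cst0 => /diag2_inj/(_ 0)/matrixP.
(* The off-diagonal position (1, 0), available because v is at least 2. *)
move/(_ (Ordinal hv) (Ordinal (ltnW hv)))/eqP.
by rewrite !mxE subr0 oner_eq0.
Qed.

Lemma A0mx_neq0 (i : 'Z_n) : A0mx R v i != 0.
Proof.
rewrite A0mxE; apply/eqP; rewrite -diag2_cst0 => /diag2_inj/(_ i)/matrixP.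
by move/(_ (Ordinal hv) (Ordinal hv))/eqP; rewrite !mxE !eqxx mulr1 oner_eq0.
Qed.

Lemma A2mx_neq0 (i : 'Z_n) : A2mx R W i != 0.
Proof.
have [rowW _ _] := hW; have := rowW (Ordinal hv).
move=> E; move: hk; rewrite -E => /card_gt0P[y]; rewrite inE.
case Wg: (W _ y) => [g|] // _.
(* One nonzero entry g of W serves every i: the coefficient of P^(g - i) in the upper block is
   B_g. *)
rewrite A2mxE; apply/eqP; rewrite -anti2_cst0 => /anti2_injl/(_ (g - i))/matrixP.
move/(_ (Ordinal hv) y)/eqP.
by rewrite !mxE addrC subrK Wg eqxx oner_eq0.
Qed.

Lemma A3mx_neq0 : (k < v)%N -> A3mx R W != 0.
Proof.
have [rowW _ _] := hW; move=> kv.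
have : [set l | W (Ordinal hv) l != None] != setT.
  by apply: contraTneq kv => E; rewrite -(rowW (Ordinal hv)) E cardsT card_ord ltnn.
rewrite -subTset => /subsetPn[y _]; rewrite inE negbK => /eqP WN.
rewrite A3mxE; apply/eqP; rewrite -anti2_cst0 => /anti2_injl/(_ 0)/matrixP.
move/(_ (Ordinal hv) y)/eqP.
by rewrite !mxE support_mxE WN eqxx subr0 oner_eq0.
Qed.

Lemma A3mx_eq0 : k = v -> A3mx R W = 0.
Proof.
move=> kv; rewrite A3mxE (support_full _ hW kv) trmx_const subrr.
exact: anti2_cst0.
Qed.

Lemma A0mx_id : A0mx R v (0 : 'Z_n) = 1%:M.
Proof.
rewrite A0mxE scalar_mx_block /diag2 bcirc1.
by congr block_mx; apply: eq_bcirc => j; rewrite scale_scalar_mx mulr1.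
Qed.

Lemma family2_scheme : (k < v)%N -> comm_assoc_scheme (base2 n) (family2 R W).
Proof.
move=> kv; split.
- exact: family2_01.
- case=> [i|[u|[i|u]]] /=; [exact: A0mx_neq0 | exact: A1mx_neq0
    | exact: A2mx_neq0 | exact: A3mx_neq0].
- exact: A0mx_id.
- exact: sum_family2.
- case=> [i|[u|[i|u]]] ne.
  + by exists (inl (- i)); rewrite /= ?tr_A0mx // (inj_eq inl_inj) oppr_eq0.
  + by exists (inr (inl u)); rewrite //= tr_A1mx.
  + by exists (inr (inr (inl (- i)))); rewrite //= tr_A2mx.
  + by exists (inr (inr (inr u))); rewrite //= tr_A3mx.
- by apply: spanned_family2_mul => t; apply: spanned_mem.
exact: family2_comm.
Qed.

Definition index1_to_index2 (t : index1 n) : index2 n :=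
  match t with
  | inl i => inl i
  | inr (inl u) => inr (inl u)
  | inr (inr i) => inr (inr (inl i))
  end.

Lemma family1E t : family1 R W t = family2 R W (index1_to_index2 t).
Proof. by case: t => [i|[u|i]]. Qed.

(** Since A_3 vanishes here, the sum and product axioms transfer from the full family. *)
Lemma family1_scheme : k = v -> comm_assoc_scheme (base1 n) (family1 R W).
Proof.
move=> kv; split.
- by move=> t; rewrite family1E; apply: family2_01.
- case=> [i|[u|i]] /=; [exact: A0mx_neq0 | exact: A1mx_neq0 | exact: A2mx_neq0].
- exact: A0mx_id.
- by rewrite -sum_family1 A3mx_eq0 // addr0.
- case=> [i|[u|i]] ne.
  + by exists (inl (- i)); rewrite /= ?tr_A0mx // (inj_eq inl_inj) oppr_eq0.
  + by exists (inr (inl u)); rewrite //= tr_A1mx.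
  + by exists (inr (inr (- i))); rewrite //= tr_A2mx.
- move=> s t; rewrite !family1E; apply: spanned_family2_mul => {s t} t.
  case: t => [i|[u|[i|u]]] /=.
  + exact: (spanned_mem _ (inl i : index1 n)).
  + exact: (spanned_mem _ (inr (inl u) : index1 n)).
  + exact: (spanned_mem _ (inr (inr i) : index1 n)).
  + by rewrite A3mx_eq0 //; apply: spanned0.
by move=> s t; rewrite !family1E; apply: family2_comm.
Qed.

(** Symmetry of A_{0,1} alone gives -1 = 1 in Z_n, so n divides 2. *)
Lemma A0mx_sym_order : (forall i : 'Z_n, (A0mx R v i)^T = A0mx R v i) -> n = 2.
Proof.
move/(_ 1); rewrite tr_A0mx => /(A0mx_inj (ltnW hv)) E.
have : 1 + 1 == 0 :> 'Z_n by rewrite -{1}E addNr.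
by rewrite -val_eqE; case: (m).
Qed.

Lemma family2_sym_order2 : n = 2 -> symmetric_scheme (family2 R W).
Proof.
case=> m0 t; have opp (i : 'Z_n) : - i = i.
  move: i; rewrite m0; case=> [[|[|//]] lti]; exact: val_inj.
by case: t => [i|[u|[i|u]]] /=;
  rewrite ?tr_A0mx ?tr_A1mx ?tr_A2mx ?tr_A3mx ?opp.
Qed.

End Scheme.

Theorem theorem8 (R : numFieldType) (n v k lambda : nat)
    (W : 'M[option 'Z_n]_v) (hn : (2 <= n)%N) (hv : (2 <= v)%N)
    (hk : (1 <= k)%N) (hW : is_BGW k lambda W) :
  [/\ (k = v -> comm_assoc_scheme (base1 n) (family1 R W)),
      ((k < v)%N -> comm_assoc_scheme (base2 n) (family2 R W))
    & (k = v -> (symmetric_scheme (family1 R W) <-> n = 2%N)) /\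
      ((k < v)%N -> (symmetric_scheme (family2 R W) <-> n = 2%N))].
Proof.
(* The bound on n puts it in the form m + 2 used by all the lemmas. *)
case: n W hn hW => [|[|m]] // W _ hW; split.
- exact: family1_scheme hk hv hW.
- exact: family2_scheme hk hv hW.
split=> _; split=> [sym|n2].
- by apply: (@A0mx_sym_order R m v hv) => i; apply: (sym (inl i)).
- by move=> t; rewrite family1E; apply: family2_sym_order2.
- by apply: (@A0mx_sym_order R m v hv) => i; apply: (sym (inl i)).
exact: family2_sym_order2.
Qed.
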